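(* For each $n\in\mathbb{N}$, $n\ge 2$, each $k\in\mathbb{N}$, and any open subset $E$ of $\mathbb{R}$ which satisfies $$0\in E,\qquad -E=E\qquad\text{and}\qquad \mathrm{comp}(E)=2k-1,$$ there exists $f\in PD_n(\mathbb{R})$ such that $S_f=E$ and $$\mathrm{card}(D_n(f))=n^{k-1}.$$
   Context: $\mathbb{N}$ denotes the positive integers. A function $f:\mathbb{R}\to\mathbb{C}$ is positive definite if $\sum_{j,l=1}^{m} f(x_j-x_l)c_j\overline{c_l}\ge 0$ for every $m\in\mathbb{N}$, all $c_1,\dots,c_m\in\mathbb{C}$ and all $x_1,\dots,x_m\in\mathbb{R}$. $PD(\mathbb{R})$ denotes the family of continuous positive definite functions $f:\mathbb{R}\to\mathbb{C}$ that are not identically zero. For an integer $n\ge 2$, a function $f\in PD(\mathbb{R})$ is called $n$-divisible if there is $g\in PD(\mathbb{R})$ with $g^n=f$ (pointwise $n$-th power: $g(x)^n=f(x)$ for all $x\in\mathbb{R}$); $PD_n(\mathbb{R})$ denotes the family of all $n$-divisible functions in $PD(\mathbb{R})$. For $f\in PD_n(\mathbb{R})$, set $D_n(f)=\{g\in PD(\mathbb{R}): g^n=f\}$, and $\mathrm{card}(D_n(f))$ is the cardinality of this set. For $f\in PD(\mathbb{R})$, $S_f=\{x\in\mathbb{R}: f(x)\neq 0\}$ (an open subset of $\mathbb{R}$). For an open set $E\subset\mathbb{R}$, $-E=\{-x:x\in E\}$ and $\mathrm{comp}(E)$ denotes the number (cardinality of the family) of connected components of $E$; components may be unbounded. *)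

(* Defs.v *)
From HB Require Import structures.
From mathcomp Require Import all_boot all_order all_algebra.
From mathcomp Require Import complex.
From mathcomp Require Import all_classical all_reals all_analysis.

Set Implicit Arguments.
Unset Strict Implicit.
Unset Printing Implicit Defensive.

Import Order.TTheory GRing.Theory Num.Theory.
Import numFieldNormedType.Exports.

Local Open Scope classical_set_scope.
Local Open Scope complex_scope.
Local Open Scope ring_scope.

(* The order on [R[i]] is partial: [0 <= z] says that z is real and
   nonnegative. *)
Definition positive_definite (R : realType) (f : R -> R[i]) : Prop :=
  forall (m : nat) (c : 'I_m -> R[i]) (x : 'I_m -> R), (0 < m)%N ->
    0 <= \sum_(j < m) \sum_(l < m) f (x j - x l) * c j * Num.conj (c l).

(* [R[i]] itself carries no topology in the library; [R[i]^o] carries the one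
   given by the modulus. *)
Definition PD (R : realType) : set (R -> R[i]) :=
  [set f : R -> R[i] | [/\ continuous (f : R -> R[i]^o),
               positive_definite f &
               exists x, f x != 0]].

Definition Droots (R : realType) (n : nat) (f : R -> R[i]) : set (R -> R[i]) :=
  [set g | PD g /\ forall x, g x ^+ n = f x].

Definition PDn (R : realType) (n : nat) : set (R -> R[i]) :=
  [set f | PD f /\ exists2 g, PD g & forall x, g x ^+ n = f x].

Definition nonvanishing (R : realType) (f : R -> R[i]) : set R :=
  [set x | f x != 0].

Definition components (T : topologicalType) (E : set T) : set (set T) :=
  [set connected_component E x | x in E].

(* Main.v *)
Require Import Defs.
From HB Require Import structures.
From mathcomp Require Import all_boot all_order all_algebra all_field.
From mathcomp Require Import complex ring lra zify.
From mathcomp Require Import all_classical all_reals all_analysis.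
Import Order.TTheory GRing.Theory Num.Theory.
Import numFieldNormedType.Exports.
Local Open Scope classical_set_scope.
Local Open Scope card_scope.
Local Open Scope complex_scope.
Local Open Scope ring_scope.

Set Implicit Arguments.
Unset Strict Implicit.
Unset Printing Implicit Defensive.

(** Let [g >= 0] be an even function that vanishes exactly off [E], and let
    [f = g ^ n].  If [h] is a continuous [n]-th root of [f], then [h / g] is
    continuous on [E] with values in the [n]-th roots of unity, so it is
    constant on each component of [E].  If [h] is moreover positive definite,
    then [h 0 >= 0] and [h (- x)] is the conjugate of [h x]: the constant is [1]
    on the component of [0], and the constants on opposite components are
    conjugate.  Hence [h] is determined by one root of unity for each of the
    [k - 1] components contained in the positive half-line, which gives at most
    [n ^ (k - 1)] roots.

    The point is to choose [g] such that all these candidates [w * g], for [w] a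
    [phase] of [E], are positive definite.  A tent
    [T_r x = max 0 (r - |x|)] is positive definite, because [T_r (x - y)] is the
    length of the intersection of [[x, x + r]] and [[y, y + r]].  For every [c]
    and every [|w| = 1] it follows that
      [2 T_r x + w T_r (x - c) + w^* T_r (x + c)]
    is positive definite ([gram_twist]).  If [(- r, r)] and [(c - r, c + r)] lie
    in [E], then on each of the three bumps a phase is constant, equal to [1],
    [w c] and [(w c)^*], so multiplying the triple of tents with [w = 1] by the phase only
    turns it into the triple with [w = w c] ([phase_three_tents]).  Let [g] be
    the sum with weights [2 ^ - m] over all rational [c] and [r] with this
    property ([profile]).  Then [g] is positive exactly on [E], and each [w * g]
    is a limit of positive definite functions ([phase_profile_PD]).  The series
    is needed because a component may be unbounded whereas [r] is bounded by
    the size of the component of [0].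

    That [f = g ^ n] itself is positive definite is an instance of the Schur
    product theorem.  It is immediate here because the partial sums are handled
    through finite Gram factorizations ([gram]), and a product of Gram matrices
    is the Gram matrix of the tensor products.  *)

(** * Finite Gram factorizations *)

(** On any finite family of points the kernel [f (x - y)] is a finite Gram
    matrix.  This is the form of positive definiteness for which closure under
    products needs no spectral theory. *)
Definition gram (G : zmodType) (C : numClosedFieldType) (f : G -> C) : Prop :=
  forall (I : finType) (x : I -> G), exists (J : finType) (V : I -> J -> C),
    forall i l, f (x i - x l) = \sum_j V i j * Num.conj (V l j).

Section Gram.
Context (G : zmodType) (C : numClosedFieldType).
Implicit Types f g : G -> C.

Lemma gram_pd f : gram f -> forall (m : nat) (c : 'I_m -> C) (x : 'I_m -> G),
  0 <= \sum_(j < m) \sum_(l < m) f (x j - x l) * c j * Num.conj (c l).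
Proof.
move=> fG m c x; have [J [V fV]] := fG _ x.
have -> : \sum_(j < m) \sum_(l < m) f (x j - x l) * c j * Num.conj (c l) =
    \sum_q (\sum_(j < m) c j * V j q) * Num.conj (\sum_(j < m) c j * V j q).
  under [RHS]eq_bigr => q _.
    rewrite rmorph_sum big_distrl /=.
    under eq_bigr => j _ do rewrite big_distrr /=.
    over.
  rewrite [RHS]exchange_big; apply: eq_bigr => j _ /=.
  rewrite [RHS]exchange_big; apply: eq_bigr => l _ /=.
  rewrite fV !mulr_suml; apply: eq_bigr => q _.
  by rewrite rmorphM /=; ring.
by apply: sumr_ge0 => q _; rewrite -normCK exprn_ge0.
Qed.

Lemma gram_cst (a : C) : 0 <= a -> gram (fun _ : G => a).
Proof.
move=> a0 I x; exists unit, (fun _ _ => sqrtC a) => i l.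
rewrite big_const card_unit /= addr0 conj_Creal; last first.
  by rewrite ger0_real // sqrtC_ge0.
by rewrite -expr2 sqrtCK.
Qed.

Lemma gramD f g : gram f -> gram g -> gram (fun x => f x + g x).
Proof.
move=> fG gG I x; have [J [V fV]] := fG _ x; have [K [W gW]] := gG _ x.
exists (J + K)%type,
  (fun i s => match s with inl j => V i j | inr k => W i k end) => i l.
by rewrite big_sumType /= fV gW.
Qed.

Lemma gramM f g : gram f -> gram g -> gram (fun x => f x * g x).
Proof.
move=> fG gG I x; have [J [V fV]] := fG _ x; have [K [W gW]] := gG _ x.
exists (J * K)%type, (fun i s => V i s.1 * W i s.2) => i l.
rewrite fV gW big_distrlr /= pair_bigA; apply: eq_bigr => -[j k] _ /=.
by rewrite rmorphM mulrACA.
Qed.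

Lemma gram_exp f n : gram f -> gram (fun x => f x ^+ n).
Proof.
move=> fG; elim: n => [|n IH].
  by under eq_fun do rewrite expr0; exact: (gram_cst ler01).
by under eq_fun do rewrite exprS; exact: (gramM fG IH).
Qed.

Lemma gram_sum (F : nat -> G -> C) N :
  (forall m, gram (F m)) -> gram (fun x => \sum_(m < N) F m x).
Proof.
move=> FG; elim: N => [|N IH].
  by under eq_fun do rewrite big_ord0; exact: (gram_cst (lexx 0)).
by under eq_fun do rewrite big_ord_recr; exact: (gramD IH (FG N)).
Qed.

(** Over the points [x i] and [x i + c], take [V (x i) + w^* V (x i + c)] as new
    Gram vectors; the two diagonal terms of the inner product both give [f]
    since [|w| = 1]. *)
Lemma gram_twist f (c : G) (w : C) : w * Num.conj w = 1 -> gram f ->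
  gram (fun d => f d *+ 2 + w * f (d - c) + Num.conj w * f (d + c)).
Proof.
move=> w1 fG I x.
have [J [V fV]] := fG _ (fun s : I * bool => x s.1 + (if s.2 then c else 0)).
exists J, (fun i j => V (i, false) j + Num.conj w * V (i, true) j) => i l.
pose S b b' := \sum_j V (i, b) j * Num.conj (V (l, b') j).
have SE b b' : S b b' =
    f ((x i - x l) + ((if b then c else 0) - (if b' then c else 0))).
  by rewrite /S -fV /= addrACA opprD.
transitivity (S false false + w * Num.conj w * S true true + w * S false true
              + Num.conj w * S true false).
  by rewrite !SE w1 mul1r !subrr sub0r subr0 !addr0 mulr2n.
rewrite /S !mulr_sumr -!big_split /=; apply: eq_bigr => j _.
rewrite rmorphD rmorphM /= conjCK.
by ring: w1.
Qed.

End Gram.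

(** The sets [A i] cut the space into finitely many atoms, one for each set of
    indices; [A i] is represented by the vector of the square roots of the
    measures of the atoms that it contains. *)
Lemma gram_measure d (T : measurableType d) (R : realType)
    (mu : {measure set T -> \bar R}) (I : finType) (A : I -> set T) :
  (forall i, measurable (A i)) -> (forall i, (mu (A i) < +oo)%E) ->
  exists (J : finType) (V : I -> J -> R), forall i l,
    fine (mu (A i `&` A l)) = \sum_j V i j * V l j.
Proof.
move=> Am Afin.
pose atom (S : {set I}) :=
  [set t | forall i, (i \in S) = `[< A i t >]].
have atomE S : atom S =
    \bigcap_(i in [set: I]) (if i \in S then A i else ~` A i).
  apply/seteqP; split => t /= tS i.
    by move=> _; have := tS i; case: (i \in S) => /esym/asboolP.
  by have := tS i Logic.I; case: (i \in S) => /= h; apply/esym/asboolP.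
have atomM S : measurable (atom S).
  rewrite atomE; apply: fin_bigcap_measurable; first exact: finite_finset.
  by move=> i _; case: ifP => // _; exact: measurableC.
have atomT : trivIset setT atom.
  move=> S S' _ _ [t [tS tS']]; apply/setP => i.
  by rewrite tS tS'.
exists {set I}, (fun i (S : {set I}) => if i \in S then Num.sqrt (fine (mu (atom S))) else 0).
move=> i l.
pose P := [pred S : {set I} | (i \in S) && (l \in S)].
have -> : A i `&` A l = \bigcup_(S in [set` P]) atom S.
  apply/seteqP; split => [t [ti tl]|t [S /andP[iS lS] tS]].
    exists [set j : I | `[< A j t >]]%SET => [|j]; last by rewrite inE.
    by rewrite /= !inE; apply/andP; split; apply/asboolP.
  by split; apply/asboolP; rewrite -tS.
rewrite measure_fin_bigcup //; last exact: sub_trivIset atomT.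
have muS (S : {set I}) : i \in S -> mu (atom S) \is a fin_num.
  move=> iS; rewrite ge0_fin_numE //; apply: le_lt_trans (Afin i).
  apply: le_measure; rewrite ?inE // => t tS.
  by apply/asboolP; rewrite -tS.
rewrite -(bigfs _ (index_enum_uniq _)); last first.
  by move=> S _; rewrite mem_index_enum.
rewrite -sum_fine; last by move=> S /andP[iS _]; exact: muS.
rewrite big_mkcond; apply: eq_bigr => S _ /=.
case: (i \in S); case: (l \in S) => /=; rewrite ?mul0r ?mulr0 //.
by rewrite -expr2 sqr_sqrtr // fine_ge0.
Qed.

(** * Tent functions *)

Definition tent (R : realType) (r x : R) : R := Num.max 0 (r - `|x|).

Lemma tent_ge0 (R : realType) (r x : R) : 0 <= tent r x.
Proof. by rewrite le_max lexx. Qed.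

Lemma tent_le (R : realType) (r x : R) : 0 <= r -> tent r x <= r.
Proof. by move=> r0; rewrite ge_max r0 gerBl normr_ge0. Qed.

Lemma tent_gt0 (R : realType) (r x : R) : (0 < tent r x) = (`|x| < r).
Proof. by rewrite lt_max ltxx subr_gt0. Qed.

Lemma tent_lip (R : realType) (r x y : R) : `|tent r x - tent r y| <= `|x - y|.
Proof.
apply: le_trans (ler_dist_dist x y); rewrite /tent.
set a := `|x|; set b := `|y|.
have := ler_norm (a - b); have := ler_norm (b - a); rewrite (distrC b a) ler_norml.
by case: (ltP 0 (r - a)) => ?; case: (ltP 0 (r - b)) => ?; lra.
Qed.

Lemma gram_tent (R : realType) (r : R) : 0 <= r ->
  gram (fun x : R => (tent r x)%:C).
Proof.
move=> r0 I x; pose A i := `[x i, x i + r]%classic.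
have Am i : measurable (A i) by exact: measurable_itv.
have Afin i : (lebesgue_measure (A i) < +oo)%E.
  by rewrite lebesgue_measure_itv /=; case: ifP => // _; rewrite -EFinB ltry.
have [J [V AV]] := @gram_measure _ _ R lebesgue_measure I A Am Afin.
exists J, (fun i j => (V i j)%:C) => i l.
transitivity ((fine (lebesgue_measure (A i `&` A l)))%:C : R[i]).
  congr (_%:C); have -> : A i `&` A l =
      `[Num.max (x i) (x l), Num.min (x i) (x l) + r]%classic.
    apply/seteqP; split=> t; rewrite /A /= !in_itv /= addr_minl ge_max le_min.
      by move=> [/andP[-> ->] /andP[-> ->]].
    by move=> /andP[/andP[-> ->] /andP[-> ->]].
  have D : Num.min (x i) (x l) + r - Num.max (x i) (x l) = r - `|x i - x l|.
    by case: (leP (x i) (x l)) => h; [rewrite ler0_norm|rewrite gtr0_norm]; lra.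
  rewrite lebesgue_measure_itv /= lte_fin -subr_gt0 D /tent.
  by case: ltP => h //=; rewrite D.
rewrite AV rmorph_sum; apply: eq_bigr => j _ /=.
by rewrite rmorphM /= conj_Creal // complex_real.
Qed.

(** * Positive definite functions and limits *)

(** The order of [K] is only partial; nonnegativity is nevertheless a closed
    condition, namely [`|z| = z]. *)
Lemma limn_ge0 (K : numFieldType) (u : nat -> K) (l : K) :
  (forall N, 0 <= u N) -> u N @[N --> \oo] --> l -> 0 <= l.
Proof.
move=> u0 ul; rewrite ger0_def; apply/eqP.
apply: (@norm_cvg_unique K K) (ul).
have <- : (fun N => `|u N|) = u by apply/funext => N; rewrite ger0_norm.
exact: cvg_norm ul.
Qed.

Lemma pd_lim (G : zmodType) (C : numClosedFieldType) (F : nat -> G -> C)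
    (f : G -> C) :
  (forall N, gram (F N)) -> (forall x, F N x @[N --> \oo] --> f x) ->
  forall (m : nat) (c : 'I_m -> C) (x : 'I_m -> G),
    0 <= \sum_(j < m) \sum_(l < m) f (x j - x l) * c j * Num.conj (c l).
Proof.
move=> FG Ff m c x.
apply: (@limn_ge0 _ (fun N => \sum_(j < m) \sum_(l < m)
    F N (x j - x l) * c j * Num.conj (c l))) => [N|]; first exact: gram_pd.
apply: cvg_big => [|j _]; first exact: add_continuous.
apply: cvg_big => [|l _]; first exact: add_continuous.
by apply: cvgMl; apply: cvgMl; exact: Ff.
Qed.

Lemma cvg_scale_exp (K : numFieldType) (T : Type) (F : set_system T)
    {FF : Filter F} (u : T -> K) (l w : K) (n : nat) :
  u t @[t --> F] --> l -> (w * u t) ^+ n @[t --> F] --> (w * l) ^+ n.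
Proof.
move=> ul; elim: n => [|n IH].
  by under eq_fun do rewrite expr0; exact: cvg_cst.
by under eq_fun do rewrite exprS; rewrite exprS; apply: cvgM (IH); exact: cvgMr.
Qed.

(** Only [c = 1] and [c = 'i] are used: they say that [a + b] is real and that
    [b - a] is purely imaginary. *)
Lemma real_form_conj (C : numClosedFieldType) (a b : C) :
  (forall c, a * Num.conj c + b * c \is Num.real) -> b = Num.conj a.
Proof.
move=> H; have /CrealP := H 1; have /CrealP := H 'i.
rewrite !rmorphD !rmorphM !rmorph1 /= !conjCK conjCi !mulr1 => e1 e2.
have {}e1 : Num.conj a - Num.conj b = b - a.
  apply: (mulfI (neq0Ci C)).
  transitivity (Num.conj a * 'i + Num.conj b * - 'i); first by ring.
  by rewrite e1; ring.
have n2 : (2 : C) != 0 by rewrite pnatr_eq0.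
apply: (mulfI n2).
transitivity (a + b + (b - a)); first by ring.
by rewrite -e1 -e2; ring.
Qed.

Section ComplexValued.
Variable R : realType.
Implicit Types f g : R -> R[i].

Lemma cvg_real_complex (T : Type) (F : set_system T) {FF : Filter F}
    (u : T -> R) (l : R) :
  u t @[t --> F] --> l -> ((u t)%:C : R[i]^o) @[t --> F] --> (l%:C : R[i]^o).
Proof.
move=> /cvgrPdist_lt ul; apply/cvgrPdist_lt => -[e e'].
rewrite ltcE /= => /andP[/eqP -> e0].
apply: filterS (ul e e0) => t.
rewrite -rmorphB /= normc_def /= expr0n addr0 sqrtr_sqr.
by rewrite ltcR.
Qed.

Lemma pd_lim_twist (w : R -> R[i]) (S : nat -> R -> R) (g : R -> R) (n : nat) :
  (forall N, gram (fun x => w x * (S N x)%:C)) ->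
  (forall x, S N x @[N --> \oo] --> g x) ->
  positive_definite (fun x => (w x * (g x)%:C) ^+ n).
Proof.
move=> wG Sg m c x _.
apply: (@pd_lim R R[i] (fun N x => (w x * (S N x)%:C) ^+ n)
                       (fun x => (w x * (g x)%:C) ^+ n)) => [N|{m c}x].
  exact: (gram_exp n (wG N)).
exact: (@cvg_scale_exp R[i] _ _ _ _ _ _ _ (cvg_real_complex (Sg x))).
Qed.

(** The bound is only asked near each point since the phase of a twisted profile
    jumps from one component to another. *)
Lemma lipschitz_continuous f (L : R) :
  (forall x, \forall y \near x, `|f x - f y| <= (L * `|x - y|)%:C) ->
  continuous (f : R -> R[i]^o).
Proof.
move=> fL x; apply/cvgrPdist_lt => -[e e'].
rewrite ltcE /= => /andP[/eqP -> e0].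
pose M := Num.max L 1.
have M0 : 0 < M by rewrite lt_max ltr01 orbT.
near=> y.
have h : `|f x - f y| <= (L * `|x - y|)%:C by near: y; exact: fL.
apply: le_lt_trans h _; rewrite -complexr0 ltcR.
apply: (@le_lt_trans _ _ (M * `|x - y|)).
  by rewrite ler_wpM2r // le_max lexx.
rewrite -ltr_pdivlMl // mulrC.
near: y; apply: (@cvgr_dist_lt _ _ _ _ _ id); [exact: cvg_id|exact: divr_gt0].
Unshelve. all: by end_near. Qed.

Lemma pd_0_ge0 f : positive_definite f -> 0 <= f 0.
Proof.
move=> /(_ 1%N (fun=> 1) (fun=> 0) isT).
by rewrite !big_ord1 subrr rmorph1 !mulr1.
Qed.

Lemma pd_conj f x : positive_definite f -> f (- x) = Num.conj (f x).
Proof.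
move=> fp; apply: real_form_conj => c.
(* the Hermitian form at the points [x] and [0] with coefficients [1] and [c],
   minus its real diagonal part *)
have -> : f x * Num.conj c + f (- x) * c =
    \sum_(j < 2) \sum_(l < 2) f ((if j == 0 then x else 0) -
       (if l == 0 then x else 0)) * (if j == 0 then 1 else c)
         * Num.conj (if l == 0 then 1 else c) - f 0 * (1 + c * Num.conj c).
  rewrite !big_ord_recl !big_ord0 /= !subrr subr0 sub0r rmorph1.
  by ring.
apply: rpredB; first by apply: ger0_real; exact: (fp 2%N).
apply: rpredM; first exact/ger0_real/pd_0_ge0.
by rewrite rpredD ?rpred1 // -normCK realX // normr_real.
Qed.
End ComplexValued.

(** * The profile of a symmetric open set *)

Section Profile.
Context (R : realType) (E : set R).

Definition three_tents (c r x : R) : R :=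
  tent r x *+ 2 + tent r (x - c) + tent r (x + c).

(** The bound [r <= 1] makes the weighted series of tents converge. *)
Definition admissible (c r : R) : Prop :=
  [/\ 0 <= r <= 1, forall x, `|x| < r -> E x & forall x, `|x - c| < r -> E x].

(** The pairs of rationals are enumerated by [unpickle].  A pair that is not
    admissible gets radius [0], hence tents that vanish identically. *)
Definition center (m : nat) : R := ratr (odflt (0, 0) (unpickle m) : rat * rat).1.

Definition radius (m : nat) : R :=
  let r := ratr (odflt (0, 0) (unpickle m) : rat * rat).2 in
  if `[< admissible (center m) r >] then r else 0.

Definition partial_profile (N : nat) (x : R) : R :=
  \sum_(m < N) 2^-1 ^+ m * three_tents (center m) (radius m) x.

Definition profile (x : R) : R := limn (partial_profile ^~ x).

Lemma radius_admissible m : admissible (center m) (radius m).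
Proof.
rewrite /radius; case: asboolP => // _; split; first by rewrite lexx ler01.
  by move=> x; rewrite normr_lt0.
by move=> x; rewrite normr_lt0.
Qed.

Lemma three_tents_ge0 c r x : 0 <= three_tents c r x.
Proof. by rewrite !addr_ge0 ?mulrn_wge0 ?tent_ge0. Qed.

Lemma three_tents_le4 c r x : 0 <= r <= 1 -> three_tents c r x <= 4.
Proof.
move=> /andP[r0 r1]; rewrite /three_tents mulr2n.
have := tent_le x r0; have := tent_le (x - c) r0; have := tent_le (x + c) r0.
lra.
Qed.

Lemma three_tents_lip c r x y :
  `|three_tents c r x - three_tents c r y| <= 4 * `|x - y|.
Proof.
have h1 := tent_lip r x y.
have h2 : `|tent r (x - c) - tent r (y - c)| <= `|x - y|.
  by apply: le_trans (tent_lip _ _ _) _; have -> : x - c - (y - c) = x - y by ring.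
have h3 : `|tent r (x + c) - tent r (y + c)| <= `|x - y|.
  by apply: le_trans (tent_lip _ _ _) _; have -> : x + c - (y + c) = x - y by ring.
move: h1 h2 h3; rewrite /three_tents !mulr2n !ler_norml.
by move=> /andP[? ?] /andP[? ?] /andP[? ?]; apply/andP; split; lra.
Qed.

Lemma sum_half_le2 N : \sum_(m < N) 2^-1 ^+ m <= 2 :> R.
Proof.
have -> : \sum_(m < N) 2^-1 ^+ m = 2 - 2 * 2^-1 ^+ N :> R.
  elim: N => [|N IH]; first by rewrite big_ord0 expr0; lra.
  by rewrite big_ord_recr /= IH exprS; field.
by rewrite gerBl mulr_ge0 // exprn_ge0 // invr_ge0.
Qed.

Let half_ge0 m : 0 <= 2^-1 ^+ m :> R. Proof. by rewrite exprn_ge0 // invr_ge0. Qed.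

Lemma partial_profile_le8 N x : partial_profile N x <= 8.
Proof.
apply: (@le_trans _ _ (\sum_(m < N) 2^-1 ^+ m * 4)).
  apply: ler_sum => m _; rewrite ler_wpM2l //; apply: three_tents_le4.
  by case: (radius_admissible m).
rewrite -mulr_suml; have := sum_half_le2 N; lra.
Qed.

Lemma partial_profile_lip N x y :
  `|partial_profile N x - partial_profile N y| <= 8 * `|x - y|.
Proof.
rewrite -sumrB; apply: le_trans (ler_norm_sum _ _ _) _.
apply: (@le_trans _ _ (\sum_(m < N) 2^-1 ^+ m * (4 * `|x - y|))).
  apply: ler_sum => m _.
  by rewrite -mulrBr normrM ger0_norm // ler_wpM2l // three_tents_lip.
rewrite -mulr_suml mulrA ler_wpM2r //; have := sum_half_le2 N; lra.
Qed.

Lemma partial_profile_nondecreasing x :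
  {homo partial_profile ^~ x : N M / (N <= M)%N >-> N <= M}.
Proof.
apply: homo_leq => // [? ? ?|N]; first exact: le_trans.
by rewrite /partial_profile big_ord_recr /= lerDl mulr_ge0 // three_tents_ge0.
Qed.

Lemma partial_profile_cvg x : partial_profile N x @[N --> \oo] --> profile x.
Proof.
apply: nondecreasing_is_cvgn; first exact: partial_profile_nondecreasing.
by exists 8 => _ [N _ <-]; exact: partial_profile_le8.
Qed.

Lemma partial_profile_le N x : partial_profile N x <= profile x.
Proof.
apply: nondecreasing_cvgn_le; first exact: partial_profile_nondecreasing.
exact: partial_profile_cvg.
Qed.

Lemma profile_ge0 x : 0 <= profile x.
Proof. by have := partial_profile_le 0 x; rewrite /partial_profile big_ord0. Qed.

Lemma profile_lip x y : `|profile x - profile y| <= 8 * `|x - y|.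
Proof.
have h : `|partial_profile N x - partial_profile N y| @[N --> \oo]
    --> `|profile x - profile y|.
  by apply: cvg_norm; apply: cvgB; exact: partial_profile_cvg.
apply: (cvgr_to_le h); near=> N; exact: partial_profile_lip.
Unshelve. all: by end_near. Qed.

Hypothesis openE : open E.
Hypothesis E0 : E 0.
Hypothesis EN : forall x, E x -> E (- x).

Lemma open_ball_sub x : E x -> exists2 e : R, 0 < e & forall y, `|y - x| < e -> E y.
Proof.
move=> Ex; have /nbhs_ballP[e /= e0 eE] := open_nbhs_nbhs (conj openE Ex).
by exists e => // y yx; apply: eE; rewrite /ball /= distrC.
Qed.

Lemma three_tents_gt0 c r x : (0 < three_tents c r x) =
  [|| `|x| < r, `|x - c| < r | `|x + c| < r].
Proof.
rewrite -!tent_gt0 /three_tents mulr2n.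
have := tent_ge0 r (x + c); have := tent_ge0 r (x - c); have := tent_ge0 r x.
move: (tent r x) (tent r (x - c)) (tent r (x + c)) => a b d a0 b0 d0.
apply/idP/or3P => [h|[] h]; try by lra.
have [?|?] := ltP 0 a; first by constructor 1.
have [?|?] := ltP 0 b; first by constructor 2.
by constructor 3; lra.
Qed.

(** A point of [E] is covered by a tent with rational centre and radius; by
    symmetry of [E] the mirror tents do not leave [E]. *)
Lemma profile_gt0 x : (0 < profile x) <-> E x.
Proof.
split=> [|Ex].
  apply: contraPP => nEx.
  suff -> : profile x = 0 by rewrite ltxx.
  apply: (norm_cvg_unique (partial_profile_cvg (x := x))).
  suff -> : partial_profile ^~ x = fun=> 0 by exact: cvg_cst.
  apply/funext => N; rewrite /partial_profile big1 // => m _.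
  apply/eqP; rewrite mulf_eq0; apply/orP; right.
  rewrite -[_ == _]negbK; apply/negP; rewrite neq_lt ltNge three_tents_ge0 /=.
  rewrite three_tents_gt0; have [_ r1 r2] := radius_admissible m.
  move=> /or3P[/r1 //|/r2 //|h]; apply: nEx; rewrite -[x]opprK; apply: EN.
  by apply: r2; rewrite -opprD normrN.
have [e e0 eE] := open_ball_sub Ex; have [d d0 dE] := open_ball_sub E0.
(* The radius lies in [(0, s / 2)] and the centre within that radius of [x]: the
   tent around the centre then stays within [s] of [x]. *)
pose s := Num.min (Num.min e d) 1.
have s0 : 0 < s by rewrite !lt_min e0 d0 ltr01.
have [q] := rat_in_itvoo (divr_gt0 s0 (ltr0n R 2)); rewrite in_itv /= => /andP[q0 qs].
set r : R := ratr q in q0 qs.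
have xr : x - r < x + r by lra.
have [p] := rat_in_itvoo xr; rewrite in_itv /= => /andP[px xp].
set c : R := ratr p in px xp.
have [se sd s1] : [/\ s <= e, s <= d & s <= 1] by rewrite !ge_min !lexx !orbT.
have xc : `|x - c| < r by rewrite ltr_norml; lra.
have adm : admissible c r.
  split=> [|y yr|y yc]; first by lra.
    by apply: dE; rewrite subr0; apply: lt_le_trans sd; apply: lt_trans yr _; lra.
  apply: eE; apply: lt_le_trans se.
  have -> : y - x = (y - c) - (x - c) by ring.
  by apply: le_lt_trans (ler_normB _ _) _; lra.
pose m := pickle (p, q).
have cE : center m = c by rewrite /center /m pickleK.
have rE : radius m = r.
  by rewrite /radius cE /m pickleK /= -/r; case: asboolP.
apply: lt_le_trans (partial_profile_le m.+1 x).
rewrite /partial_profile big_ord_recr /= cE rE.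
apply: ltr_wpDl; first by apply: sumr_ge0 => i _; rewrite mulr_ge0 ?three_tents_ge0.
by rewrite mulr_gt0 ?exprn_gt0 ?invr_gt0 // three_tents_gt0 xc orbT.
Qed.

(** The candidates for the quotient of two positive definite roots of the same
    function that vanishes exactly off [E]: continuity makes the quotient constant
    on components, and positive definiteness gives the values at [0] and [- x]. *)
Definition phase (w : R -> R[i]) : Prop :=
  [/\ forall x y, connected_component E x y -> w x = w y,
      forall x, w (- x) = Num.conj (w x),
      w 0 = 1 &
      forall x, w x * Num.conj (w x) = 1].

Lemma ball_connected_component c r x :
  (forall y, `|y - c| < r -> E y) -> `|x - c| < r -> connected_component E c x.
Proof.
move=> cE xc; have r0 : 0 < r by exact: le_lt_trans xc.
apply: (@connected_component_max _ _ [set y | `|y - c| < r]) => //=.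
  by rewrite subrr normr0.
apply/connected_intervalP => y z /=.
by rewrite !ltr_norml => yc zc t yz; rewrite /= ltr_norml; lra.
Qed.

(** Each of the three bumps lives in one component of [E], where the phase is a
    constant. *)
Lemma phase_three_tents w c r x : phase w -> admissible c r ->
  w x * (three_tents c r x)%:C = (tent r x)%:C *+ 2 +
    w c * (tent r (x - c))%:C + Num.conj (w c) * (tent r (x + c))%:C.
Proof.
move=> [wc wN w0 _] [_ rE cE].
have tz y (a b : R[i]) : (`|y| < r -> a = b) -> a * (tent r y)%:C = b * (tent r y)%:C.
  move=> ab; have [/ab -> //|ry] := boolP (`|y| < r).
  suff -> : tent r y = 0 by rewrite !mulr0.
  by apply/le_anti; rewrite tent_ge0 leNgt tent_gt0 ry.
rewrite /three_tents !mulr2n !rmorphD /= !mulrDr -!mulr2n.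
congr (_ *+ 2 + _ + _).
- rewrite -[RHS]mul1r; apply: tz => xr; rewrite -w0; apply/esym/wc.
  by apply: (@ball_connected_component _ r) => [y|]; rewrite subr0 //; exact: rE.
- by apply: tz => xr; apply/esym/wc; exact: ball_connected_component cE xr.
- apply: tz => xr; rewrite -[x]opprK wN; congr (Num.conj _); apply/esym/wc.
  by apply: ball_connected_component cE _; rewrite -opprD normrN.
Qed.

Lemma gram_phase_partial w N : phase w ->
  gram (fun x => w x * (partial_profile N x)%:C).
Proof.
move=> pw; have [wc wN w0 w1] := pw.
pose F m x := (2^-1 ^+ m)%:C * ((tent (radius m) x)%:C *+ 2 +
  w (center m) * (tent (radius m) (x - center m))%:C +
  Num.conj (w (center m)) * (tent (radius m) (x + center m))%:C).
have -> : (fun x => w x * (partial_profile N x)%:C) =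
    (fun x => \sum_(m < N) F m x).
  apply/funext => x; rewrite rmorph_sum mulr_sumr; apply: eq_bigr => m _ /=.
  by rewrite rmorphM /= mulrCA (phase_three_tents _ pw (radius_admissible m)).
apply: gram_sum => m; apply: gramM.
  by apply: gram_cst; rewrite ler0c.
apply: (@gram_twist R R[i] (fun x => (tent (radius m) x)%:C)) => //.
by apply: gram_tent; have [/andP[]] := radius_admissible m.
Qed.

Lemma phase_1 : phase (fun=> 1).
Proof. by split => // *; rewrite rmorph1 ?mulr1. Qed.

Lemma phase_profile_pd w n : phase w ->
  positive_definite (fun x => (w x * (profile x)%:C) ^+ n).
Proof.
move=> pw; apply: (@pd_lim_twist _ w partial_profile) => [N|x].
  exact: gram_phase_partial.
exact: partial_profile_cvg.
Qed.

(** On [E] the phase is locally constant; off [E] the profile vanishes, so that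
    there the modulus of the phase alone matters. *)
Lemma phase_profile_continuous w : phase w ->
  continuous (fun x => w x * (profile x)%:C : R[i]^o).
Proof.
move=> [wc wN w0 w1].
have nw x : `|w x| = 1.
  by apply/eqP; rewrite -(@pexpr_eq1 _ _ 2) // normCK w1.
apply: (@lipschitz_continuous R _ 8) => x.
have lip y : `|(profile x)%:C - (profile y)%:C| <= (8 * `|x - y|)%:C :> R[i].
  rewrite -rmorphB normc_def /= expr0n addr0 sqrtr_sqr lecR.
  exact: profile_lip.
have [Ex|nEx] := pselect (E x).
  have [e e0 eE] := open_ball_sub Ex.
  apply: filterS (nbhsx_ballx x e e0) => y xy; have <- : w x = w y.
    by apply: wc; apply: ball_connected_component eE _; rewrite distrC.
  by rewrite -mulrBr normrM nw mul1r.
have px : profile x = 0.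
  apply/eqP; case: (eqVneq (profile x) 0) => // px0.
  by exfalso; apply: nEx; apply/profile_gt0; rewrite lt_def px0 profile_ge0.
apply: filterS (@filterT _ (nbhs x) _) => y _; apply: le_trans (lip y).
by rewrite px mulr0 !sub0r !normrN normrM nw mul1r.
Qed.

Lemma phase_profile_PD w : phase w -> PD (fun x => w x * (profile x)%:C).
Proof.
move=> pw; split; first exact: phase_profile_continuous.
  exact: (phase_profile_pd 1 pw).
exists 0; have [_ _ -> _] := pw.
by rewrite mul1r eq_complex /= eqxx andbT gt_eqF //; apply/profile_gt0.
Qed.

End Profile.

(** * Continuous roots *)

Lemma unity_roots_enum (C : numClosedFieldType) (n : nat) : (0 < n)%N ->
  exists u : 'I_n -> C, [/\ injective u, forall i, u i ^+ n = 1 &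
    forall z, z ^+ n = 1 -> exists i, z = u i].
Proof.
move=> n0; pose p : {poly C} := 'X^n - 1.
have [r Dp] := closed_field_poly_normal p.
rewrite (monicP _) ?monicXnsubC // scale1r in Dp.
have sz_r : size r = n.
  by apply: succn_inj; rewrite -(size_prod_XsubC r id) -Dp size_XnsubC.
have ur : uniq r.
  by rewrite -separable_prod_XsubC -Dp separable_Xn_sub_1 // pnatr_eq0 -lt0n.
have rE z : (z \in r) = (z ^+ n == 1).
  by rewrite -root_prod_XsubC -Dp /root !hornerE subr_eq0.
exists (fun i => r`_i); split=> [i j /eqP|i|z /eqP].
- by rewrite nth_uniq ?sz_r // => /eqP /val_inj.
- by apply/eqP; rewrite -rE mem_nth ?sz_r.
- rewrite -rE => zr; have ir : (index z r < n)%N by rewrite -sz_r index_mem.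
  by exists (Ordinal ir); rewrite nth_index.
Qed.

(** The set where [h = w * g] is closed, and it is also open in [A]: by
    [h ^ n = (w * g) ^ n] its complement is the zero set of the cofactor of
    [h - w * g], which equals [n h ^ (n - 1) <> 0] where [h = w * g]. *)
Lemma root_ratio_connected (T : topologicalType) (K : numFieldType)
    (g h : T -> K) (A : set T) (n : nat) :
  (0 < n)%N -> continuous g -> continuous h -> connected A ->
  (forall x, A x -> g x != 0) -> (forall x, h x ^+ n = g x ^+ n) ->
  forall x y w, A x -> A y -> h x = w * g x -> h y = w * g y.
Proof.
move=> n0 gc hc Ac g0 hg x y w Ax Ay hx.
have w1 : w ^+ n = 1.
  apply: (mulIf (expf_neq0 n (g0 x Ax))).
  by rewrite mul1r -exprMn -hx hg.
have closed0 (f : T -> K) : continuous f -> closed [set t | f t = 0].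
  move=> fc; apply: (@preimage_closed _ _ f [set 0]) => [t _|]; first exact: fc.
  exact/accessible_closed_set1/hausdorff_accessible/norm_hausdorff.
have wgc : continuous (fun t => w * g t) by move=> t; apply: cvgMr; exact: gc.
have expc (f : T -> K) k : continuous f -> continuous (fun t => f t ^+ k).
  move=> fc t; have -> : (fun t => f t ^+ k) = (fun t => (1 * f t) ^+ k).
    by apply/funext => s; rewrite mul1r.
  by apply: cvg_scale_exp; exact: fc.
pose q t := \sum_(i < n) h t ^+ (n.-1 - i) * (w * g t) ^+ i.
have qc : continuous q.
  move=> t; apply: cvg_big => [|i _]; first exact: add_continuous.
  by apply: cvgM; apply: expc.
have hq t : (h t - w * g t) * q t = 0.
  by rewrite -subrXX hg exprMn w1 mul1r subrr.
have qE t : h t = w * g t -> q t = (h t ^+ n.-1) *+ n.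
  move=> e; rewrite /q -e (eq_bigr (fun=> h t ^+ n.-1)) => [|i _].
    by rewrite sumr_const card_ord.
  by rewrite -exprD subnK // -ltnS prednK.
have <- // : A `&` [set t | h t - w * g t = 0] = A -> h y = w * g y.
  by move=> e; have : A y by []; rewrite -e => -[_ /eqP]; rewrite subr_eq0 => /eqP.
apply: Ac.
- by exists x; split => //=; rewrite hx subrr.
- exists (~` [set t | q t = 0]); first by rewrite openC; exact: closed0.
  apply/seteqP; split => t [At /=] => [e|qt]; split => //=.
    have {}e : h t = w * g t by apply/eqP; rewrite -subr_eq0 e.
    rewrite qE // => /eqP; rewrite mulrn_eq0 gtn_eqF //= expf_eq0.
    by move=> /andP[_ /eqP h0]; have := expf_neq0 n (g0 t At);
      rewrite -hg h0 expr0n gtn_eqF // eqxx.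
  by have /eqP := hq t; rewrite mulf_eq0 => /orP[/eqP //|/eqP].
- exists [set t | h t - w * g t = 0] => //; apply: closed0 => t.
  by apply: cvgB; [exact: hc|exact: wgc].
Qed.

Lemma card_finType (T : finType) : [set: T] #= `I_#|T|.
Proof.
apply/card_set_bijP; exists (fun x => nat_of_ord (enum_rank x)); split.
- by move=> x _ /=.
- by move=> x y _ _ /ord_inj /enum_rank_inj.
- move=> m /= mT; exists (enum_val (Ordinal mT)) => //.
  by rewrite enum_valK.
Qed.

(** * Components of a symmetric set *)

Section SymmetricSet.
Context (R : realType) (E : set R).
Hypothesis E0 : E 0.
Hypothesis EN : forall x, E x -> E (- x).

Local Notation comp := (connected_component E).

Definition positive_components : set (set R) :=
  [set C | components E C /\ C `<=` [set x | 0 < x]].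

Local Notation P := positive_components.
Local Notation opp := (fun C : set R => [set - x | x in C]).

Lemma connected_componentN x y : comp x y -> comp (- x) (- y).
Proof.
move=> xy; have Ex : E x.
  by have [//|nEx] := pselect (E x); move: xy; rewrite connected_component_out.
apply: (@connected_component_max _ _ (opp (comp x))); last by exists y.
- by exists x => //; exact: connected_component_refl.
- by move=> _ [z /connected_component_sub Ez <-]; exact: EN.
- apply: connected_continuous_connected; first exact: component_connected.
  by apply: continuous_subspaceT; exact: opp_continuous.
Qed.

Lemma connected_componentNE x : comp (- x) = opp (comp x).
Proof.
apply/seteqP; split=> [y /connected_componentN|_ [y xy <-]].
  by rewrite opprK => xy; exists (- y); rewrite ?opprK.
exact: connected_componentN.
Qed.

(** If neither the component of [x] nor that of [- x] lies in the positive
    half-line, then the component of [x] is an interval that meets both closed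
    half-lines, so it contains [0]. *)
Lemma component_trichotomy x : E x ->
  [\/ comp 0 x, P (comp x) | P (comp (- x))].
Proof.
move=> Ex.
have [pos|/existsNP[y /not_implyP[xy /negP y0]]] :=
  pselect (comp x `<=` [set z | 0 < z]).
  by constructor 2; split => //; exists x.
have [neg|/existsNP[z /not_implyP[xz /negP z0]]] :=
  pselect (comp (- x) `<=` [set z | 0 < z]).
  by constructor 3; split => //; exists (- x) => //; exact: EN.
constructor 1; apply: connected_component_sym.
have /connected_intervalP := @component_connected _ E x.
apply; [exact: xy| |].
  by have := connected_componentN xz; rewrite opprK; exact.
by rewrite -!leNgt /= in y0 z0 *; rewrite y0 oppr_ge0.
Qed.

Lemma componentsE : components E = comp 0 |` (P `|` opp @` P).
Proof.
apply/seteqP; split=> [_ [x Ex <-]|C].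
  have [x0|Px|Px] := component_trichotomy Ex.
  - by left; exact/esym/same_connected_component.
  - by right; left.
  - right; right; exists (comp (- x)) => //.
    by rewrite -connected_componentNE opprK.
move=> [->|[[] //|[_ [[x Ex <-] _] <-]]]; first by exists 0.
by exists (- x); [exact: EN|exact: connected_componentNE].
Qed.

Lemma positive_components_card k :
  components E #= `I_(2 * k - 1)%N -> P #= `I_(k - 1)%N.
Proof.
move=> cE.
have Cn C : components E C -> exists x, C x.
  by move=> [x Ex <-]; exists x; exact: connected_component_refl.
have finE : finite_set (components E) by exists (2 * k - 1)%N.
have finP : finite_set P by apply: sub_finite_set finE => C [].
have finN : finite_set (opp @` P) by exact: finite_image.
have [p Pp] : exists p, P #= `I_p by [].
(* The map [opp] is injective, so there are as many negative components. *)
have Np : opp @` P #= `I_p.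
  apply: card_eq_trans (inj_card_eq _) Pp.
  move=> C D _ _ /(congr1 (fun A => opp A)).
  have oppK (A : set R) : opp (opp A) = A.
    apply/seteqP; split=> [_ [_ [x Ax <-] <-]|x Ax]; first by rewrite opprK.
    by exists (- x); [exists x|rewrite opprK].
  by rewrite !oppK.
have PN : P `&` opp @` P = set0.
  apply/seteqP; split => // C [[KC Cpos] [D [_ Dpos] DC]].
  have [x Cx] := Cn C KC; have /= x0 := Cpos x Cx.
  move: Cx; rewrite -DC => -[y /Dpos /= y0 yx].
  by move: x0; rewrite -yx oppr_gt0 ltNge ltW.
have C0 : comp 0 0 by exact: connected_component_refl.
have n0 : ~ (P `|` opp @` P) (comp 0).
  move=> [[_ /(_ 0 C0) /=]|[D [_ Dpos] DC]]; first by rewrite ltxx.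
  by move: C0; rewrite -DC => -[y /Dpos /= y0 /eqP]; rewrite oppr_eq0 gt_eqF.
have := card_fset_set cE; rewrite componentsE fset_setU1 ?finite_setU //.
rewrite finmap.cardfsU1 in_fset_set ?finite_setU // memNset // fset_setU //.
rewrite finmap.cardfsU -fset_setI // PN fset_set0.
rewrite (card_fset_set Pp) (card_fset_set Np) subn0 => /= e.
by have -> : (k - 1 = p)%N by lia.
Qed.

End SymmetricSet.

(** * Phases from labels of the positive components *)

Section LabelPhase.
Context (R : realType) (E : set R) (p : nat) (F : nat -> set R).
Hypothesis EN : forall x, E x -> E (- x).
Hypothesis FP : set_bij `I_p (positive_components E) F.
Implicit Type a : 'I_p -> R[i].

(** The value is [a i] on [F i], its conjugate on the mirror image of [F i] and
    [1] elsewhere: at most one factor differs from [1].  Written as a product,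
    the phase needs no choice of the component that contains [x]. *)
Definition label_phase a (x : R) : R[i] :=
  (\prod_(i < p) (if x \in F i then a i else 1)) *
  (\prod_(i < p) (if - x \in F i then Num.conj (a i) else 1)).

Let Fpos (i : 'I_p) : positive_components E (F i).
Proof. by have [Fsub _ _] := FP; apply: Fsub; exact: ltn_ord. Qed.

Let Fgt0 (i : 'I_p) x : F i x -> 0 < x.
Proof. by have [_] := Fpos i; apply. Qed.

Lemma label_component (i : 'I_p) x : F i x -> F i = connected_component E x.
Proof.
have [[z Ez <-] _] := Fpos i; exact: same_connected_component.
Qed.

Let FN_false (i : 'I_p) x : 0 <= x -> (- x \in F i) = false.
Proof.
move=> x0; apply: memNset => /Fgt0; rewrite oppr_gt0 ltNge x0 //.
Qed.

Lemma label_phaseE a (i : 'I_p) x : F i x -> label_phase a x = a i.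
Proof.
move=> Fx; have x0 := Fgt0 Fx; rewrite /label_phase [X in _ * X]big1 => [|j _].
  rewrite (bigD1 i) //= mem_set // big1 ?mulr1 // => j ji.
  case: ifP => // /set_mem Fjx; case/eqP: ji; apply/val_inj.
  have [_ Finj _] := FP; apply: Finj; rewrite ?inE /= ?ltn_ord //.
  by rewrite (label_component Fjx) (label_component Fx).
by rewrite FN_false // ltW.
Qed.

Lemma label_phase_phase a : (forall i, a i * Num.conj (a i) = 1) ->
  phase E (label_phase a).
Proof.
move=> a1.
have FE (i : 'I_p) x y : connected_component E x y -> (x \in F i) = (y \in F i).
  have [[z Ez <-] _] := Fpos i => xy.
  apply/idP/idP => /set_mem zx; apply/mem_set.
    exact: connected_component_trans zx xy.
  exact/(connected_component_trans zx)/connected_component_sym.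
split=> [x y xy|x||x].
- congr (_ * _); apply: eq_bigr => i _; first by rewrite (FE i _ _ xy).
  by rewrite (FE i _ _ (connected_componentN EN xy)).
- rewrite /label_phase opprK rmorphM !rmorph_prod mulrC.
  by congr (_ * _); apply: eq_bigr => i _; case: ifP => _ /=;
    rewrite ?rmorph1 ?conjCK.
- rewrite /label_phase !big1 ?mulr1 // => i _; rewrite ?oppr0.
    by rewrite -[0]oppr0 FN_false.
  by rewrite -[0]oppr0 FN_false.
- rewrite /label_phase rmorphM mulrACA !rmorph_prod -!big_split /= big1 // => i _.
  have a1' : Num.conj (a i) * Num.conj (Num.conj (a i)) = 1.
    by rewrite conjCK mulrC.
  by case: ifP => _; case: ifP => _; rewrite ?rmorph1 ?a1' ?a1 ?mulr1.
Qed.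

Lemma label_phaseX a n x : (forall i, a i ^+ n = 1) -> label_phase a x ^+ n = 1.
Proof.
move=> an; rewrite /label_phase exprMn -!prodrXl !big1 ?mulr1 // => i _.
  by case: ifP => _; rewrite ?expr1n // -rmorphXn /= an rmorph1.
by case: ifP => _; rewrite ?expr1n.
Qed.

End LabelPhase.

(** * The number of positive definite roots *)

Theorem theorem2 (R : realType) (n k : nat) (E : set R) :
  (2 <= n)%N -> (1 <= k)%N ->
  open E -> E 0 -> [set - x | x in E] = E ->
  components E #= `I_(2 * k - 1)%N ->
  exists f : R -> R[i],
    [/\ PDn n f, nonvanishing f = E & Droots n f #= `I_(n ^ (k - 1))%N].
Proof.
move=> n2 _ openE E0 ENE cE.
have n0 : (0 < n)%N by exact: ltnW.
have EN x : E x -> E (- x) by move=> Ex; rewrite -ENE; exists x.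
have Pcard := positive_components_card E0 EN cE.
set p := (k - 1)%N in Pcard *.
have [F FP] : exists F : nat -> set R, set_bij `I_p (positive_components E) F.
  by apply/card_set_bijP; rewrite card_eq_sym.
have [u [u_inj u1 uP]] := unity_roots_enum R[i] n0.
have unit1 (z : R[i]) : z ^+ n = 1 -> z * Num.conj z = 1.
  move=> zn; have /eqP : `|z| ^+ n = 1 by rewrite -normrX zn normr1.
  by rewrite pexpr_eq1 // -normCK => /eqP ->; rewrite expr1n.
pose g x : R[i] := (profile E x)%:C.
have pE x : (0 < profile E x) <-> E x by exact: profile_gt0.
have g0 x : E x -> g x != 0.
  by move=> /pE px; rewrite eq_complex /= eqxx andbT gt_eqF.
have g_out x : ~ E x -> g x = 0.
  move=> nEx; have [/pE //|px] := ltP 0 (profile E x).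
  by congr (_%:C); apply/le_anti; rewrite px profile_ge0.
pose tw (s : {ffun 'I_p -> 'I_n}) x := label_phase F (fun i : 'I_p => u (s i)) x * g x.
have tw_phase (s : {ffun 'I_p -> 'I_n}) : phase E (label_phase F (fun i : 'I_p => u (s i))).
  by apply: label_phase_phase => // i; exact: unit1.
have twPD s : PD (tw s) by exact: phase_profile_PD.
have g1E : g = (fun x => 1 * g x) by apply/funext => x; rewrite mul1r.
have gPD : PD g by rewrite g1E; exact: (phase_profile_PD openE E0 EN (phase_1 E)).
have fpd : positive_definite (fun x => g x ^+ n).
  by rewrite g1E; exact: (phase_profile_pd n (phase_1 E)).
have Fz (i : 'I_p) : exists2 z, E z & F i z.
  have [Fsub _ _] := FP; have [[z Ez Fz] _] := Fsub i (ltn_ord i).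
  by exists z => //; rewrite -Fz; exact: connected_component_refl.
have rootsE : Droots n (fun x => g x ^+ n) = [set tw s | s in [set: {ffun 'I_p -> 'I_n}]].
  apply/seteqP; split=> [h [hPD hn]|_ [s _ <-]]; last first.
    split=> // x; rewrite /tw exprMn (@label_phaseX _ _ _ _ n) ?mul1r // => i.
  have {}hn x : h x ^+ n = g x ^+ n by exact: hn.
  have [hc hp _] := hPD; have [gc gp _] := gPD.
  have rigid x y w : connected_component E x y -> E x -> h x = w * g x -> h y = w * g y.
    move=> xy Ex; apply: (@root_ratio_connected R R[i] g h
      (connected_component E x) n n0 gc hc) => //.
    - exact: component_connected.
    - by move=> t /connected_component_sub; exact: g0.
    - exact: connected_component_refl.
  have label (i : 'I_p) : exists j : 'I_n, forall x, F i x -> h x = u j * g x.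
    have [z Ez Fiz] := Fz i.
    have [j zj] : exists j, h z / g z = u j.
      by apply: uP; rewrite expr_div_n hn divff // expf_neq0 // g0 //.
    exists j => x; rewrite (label_component FP Fiz) => zx.
    by apply: (rigid z x) => //; rewrite -zj divfK // g0.
  have [s hs] := fin_all_exists label.
  exists (finfun s) => //; apply/funext => x.
  have hF y : positive_components E (connected_component E y) -> E y -> h y = tw (finfun s) y.
    move=> Py Ey; have [_ _ Fsurj] := FP; have [i /= ip Fi] := Fsurj _ Py.
    have Fy : F (Ordinal ip) y by rewrite /= Fi; exact: connected_component_refl.
    by rewrite (hs _ _ Fy) /tw (label_phaseE FP _ Fy) ffunE.
  have [Ex|nEx] := pselect (E x); last first.
    rewrite /tw g_out // mulr0; apply/esym/eqP.
    have := expf_eq0 (h x) n; rewrite n0 /= => <-.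
    by rewrite hn g_out // expr0n gtn_eqF.
  (* On the component of [0] both functions have the same nonnegative value at
     [0]; on negative components both are determined by hermitian symmetry. *)
  have [x0|Px|Px] := component_trichotomy EN Ex.
  - have [wc _ w0 _] := tw_phase (finfun s); rewrite /tw -(wc _ _ x0) w0.
    apply/esym; apply: (rigid 0 x) => //; rewrite mul1r; apply/eqP.
    rewrite -(eqrXn2 n0) ?hn //; exact: pd_0_ge0.
  - exact/esym/hF.
  - rewrite -[x]opprK (pd_conj _ hp) (hF (- x)) //; last exact: EN.
    by have [_ twp _] := twPD (finfun s); exact: (pd_conj (- x) twp).
exists (fun x => g x ^+ n); split.
- split; last by exists g.
  have [gc gp _] := gPD; split => //.
  + by rewrite g1E => x; exact: (@cvg_scale_exp R[i] R (nbhs x) _ g (g x) 1 n (gc x)).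
  + by exists 0; rewrite expf_neq0 // g0.
- apply/seteqP; split=> [x /=|x Ex]; last by rewrite /nonvanishing /= expf_neq0 // g0.
  by apply: contra_neqP => nEx; rewrite g_out // expr0n gtn_eqF.
- rewrite rootsE.
  have tw_inj : {in [set: {ffun 'I_p -> 'I_n}] &, injective tw}.
    move=> s t _ _ st; apply/ffunP => i; have [z Ez Fiz] := Fz i.
    apply: u_inj; apply: (mulIf (g0 z Ez)).
    by have := congr1 (fun f => f z) st; rewrite /tw !(label_phaseE FP _ Fiz).
  apply: card_eq_trans (inj_card_eq tw_inj) _.
  by have := card_finType {ffun 'I_p -> 'I_n}; rewrite card_ffun !card_ord.
Qed.
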